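(* Let $\theta\in(\pi,2\pi)$. Then for all $x,y\in S_\theta$, $$(\pi/\theta)\,s_{S_\theta}(x,y)\le{\rm th}(\rho_{S_\theta}(x,y)/2)\le s_{S_\theta}(x,y),$$ and this inequality is sharp.
   Context: $S_\theta=\{x\in\mathbb{C}:0<\arg(x)<\theta\}$. For a domain $G\subsetneq\mathbb{C}$, $s_G(x,y)=\frac{|x-y|}{\inf_{z\in\partial G}(|x-z|+|z-y|)}$. The hyperbolic metric of $\mathbb{H}^2=\{z:{\rm Im}\,z>0\}$ satisfies ${\rm th}(\rho_{\mathbb{H}^2}(u,v)/2)=|u-v|/|u-\overline{v}|$, and $\rho_{S_\theta}(x,y)=\rho_{\mathbb{H}^2}(x^{\pi/\theta},y^{\pi/\theta})$ (principal branch power, a conformal map of $S_\theta$ onto $\mathbb{H}^2$). *)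

(* Defs.v *)
From Stdlib Require Import Reals Lra ClassicalEpsilon.
From Coquelicot Require Import Coquelicot.
Open Scope R_scope.

Definition polar (r phi : R) : C := (r * cos phi, r * sin phi).

(* argument of z with values in [0, 2*PI) (needed since theta > PI);
   for z = 0 an unspecified value *)
Definition arg (z : C) : R :=
  epsilon (inhabits 0)
    (fun phi => 0 <= phi < 2 * PI /\ z = polar (Cmod z) phi).

Definition sector (theta : R) (x : C) : Prop :=
  x <> 0%C /\ 0 < arg x < theta.

(* power x^a (branch with arg in [0,2*PI)); only used for x <> 0 *)
Definition cpow (x : C) (a : R) : C :=
  polar (Rpower (Cmod x) a) (a * arg x).

Definition closure_C (G : C -> Prop) (z : C) : Prop :=
  forall eps : R, 0 < eps -> exists w, G w /\ Cmod (w - z) < eps.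
Definition interior_C (G : C -> Prop) (z : C) : Prop :=
  exists eps : R, 0 < eps /\ forall w, Cmod (w - z) < eps -> G w.
Definition boundary_C (G : C -> Prop) (z : C) : Prop :=
  closure_C G z /\ ~ interior_C G z.

Definition s_metric (G : C -> Prop) (x y : C) : R :=
  Cmod (x - y) /
  real (Glb_Rbar (fun t => exists z, boundary_C G z /\ t = Cmod (x - z) + Cmod (z - y))).

Definition th (t : R) : R := (exp t - exp (- t)) / (exp t + exp (- t)).
Definition artanh (t : R) : R := ln ((1 + t) / (1 - t)) / 2.

(* hyperbolic metric of the upper half plane: th(rho/2) = |u-v|/|u - conj v| *)
Definition rho_H (u v : C) : R := 2 * artanh (Cmod (u - v) / Cmod (u - Cconj v)).

(* hyperbolic metric of the sector via the conformal map x |-> x^(PI/theta) *)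
Definition rho_S (theta : R) (x y : C) : R :=
  rho_H (cpow x (PI / theta)) (cpow y (PI / theta)).

(* Main.v *)
Require Import Defs.
From Stdlib Require Import Reals Lra Classical ClassicalEpsilon.
From Coquelicot Require Import Coquelicot.
Open Scope R_scope.

(** Write [a = PI / theta], [x = polar r phi], [y = polar s psi], [t = ln r - ln s] and
    [q t phi = cosh t - cos phi]. Let [delta = |phi - psi|] and
    [sigma = min (phi + psi) (2 theta - phi - psi)]. Then
    [th^2 = q (a t) (a delta) / q (a t) (a sigma)], and the law of cosines together with
    reflection in the two sides of the sector gives
    [s^2 = q t (min delta PI) / q t (min sigma PI)].
    The upper bound holds because [phi |-> q t phi / q (a t) (a phi)] decreases on [[0, PI]].
    By the same monotonicity the lower bound reduces to the extreme case [sigma = theta],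
    which is concavity of [tanh] and [sin]. On the bisector of the sector [s = tanh h] and
    [th = tanh (a h)], so [h -> 0] and [h -> oo] show that both constants are sharp. *)

(** * Hyperbolic and trigonometric functions of a scaled argument *)

(** Mean value theorem in the form used for the scaling inequalities: the sign at 0 and the sign of
    the derivative on the interval decide. *)
Lemma nonneg_of_derive (f df : R -> R) (b : R) :
  (forall x, is_derive f x (df x)) -> (forall x, 0 <= x <= b -> 0 <= df x) ->
  0 <= b -> 0 <= f 0 -> 0 <= f b.
Proof.
intros Hf Hdf Hb H0.
destruct (MVT_gen f 0 b df) as [c [Hc E]].
- intros x _; apply Hf.
- intros x _; apply continuity_pt_filterlim, (ex_derive_continuous f x).
  exists (df x); apply Hf.
- rewrite Rmin_left, Rmax_right in Hc by lra.
  specialize (Hdf c Hc); nra.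
Qed.

Lemma is_derive_cosh (x : R) : is_derive cosh x (sinh x).
Proof. apply is_derive_Reals, derivable_pt_lim_cosh. Qed.

Lemma is_derive_sinh (x : R) : is_derive sinh x (cosh x).
Proof. apply is_derive_Reals, derivable_pt_lim_sinh. Qed.

Lemma is_derive_cosh_scal (a x : R) : is_derive (fun x => cosh (a * x)) x (a * sinh (a * x)).
Proof.
apply (is_derive_comp cosh (fun x => a * x)); [apply is_derive_cosh|].
auto_derive; [easy|ring].
Qed.

Lemma is_derive_sinh_scal (a x : R) : is_derive (fun x => sinh (a * x)) x (a * cosh (a * x)).
Proof.
apply (is_derive_comp sinh (fun x => a * x)); [apply is_derive_sinh|].
auto_derive; [easy|ring].
Qed.

Lemma cosh_ge_1 (x : R) : 1 <= cosh x.
Proof.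
unfold cosh; rewrite exp_Ropp; pose proof (exp_pos x).
apply (Rmult_le_reg_r (2 * exp x)); [lra|].
field_simplify; [|lra]; pose proof (Rle_0_sqr (exp x - 1)); unfold Rsqr in *; lra.
Qed.

Lemma cosh_opp (x : R) : cosh (- x) = cosh x.
Proof. unfold cosh; rewrite Ropp_involutive; lra. Qed.

Lemma cosh_Rabs (x : R) : cosh (Rabs x) = cosh x.
Proof. unfold Rabs; destruct (Rcase_abs x); [apply cosh_opp|easy]. Qed.

Lemma sinh_nonneg (x : R) : 0 <= x -> 0 <= sinh x.
Proof.
intros Hx; apply (nonneg_of_derive sinh cosh); auto using is_derive_sinh.
- intros y _; pose proof (cosh_ge_1 y); lra.
- rewrite sinh_0; lra.
Qed.

Lemma cosh_le (x y : R) : 0 <= x <= y -> cosh x <= cosh y.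
Proof.
intros H.
destruct (MVT_gen cosh x y sinh) as [c [Hc E]].
- intros z _; apply is_derive_cosh.
- intros z _; apply derivable_continuous_pt; exists (sinh z); apply derivable_pt_lim_cosh.
- rewrite Rmin_left, Rmax_right in Hc by lra.
  pose proof (sinh_nonneg c ltac:(lra)); nra.
Qed.

Lemma cosh_double (x : R) : cosh (2 * x) = 1 + 2 * (sinh x * sinh x).
Proof.
unfold cosh, sinh; replace (2 * x) with (x + x) by ring.
rewrite Ropp_plus_distr, !exp_plus, !exp_Ropp.
pose proof (exp_pos x); field; lra.
Qed.

Lemma cosh_sqr (x : R) : cosh x * cosh x = 1 + sinh x * sinh x.
Proof.
unfold cosh, sinh; rewrite !exp_Ropp.
pose proof (exp_pos x); field; lra.
Qed.

Section Scaling.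
Variable a : R.
Hypothesis Ha : 0 < a < 1.

Lemma cosh_scal_le (x : R) : 0 <= x -> cosh (a * x) <= cosh x.
Proof. intros; apply cosh_le; nra. Qed.

(** Convexity of [sinh] on the half-line: the difference vanishes at 0 and increases because [cosh]
    does. *)
Lemma sinh_scal_le (x : R) : 0 <= x -> sinh (a * x) <= a * sinh x.
Proof.
intros Hx; apply Rminus_le_0.
apply (nonneg_of_derive (fun x => a * sinh x - sinh (a * x))
         (fun x => a * cosh x - a * cosh (a * x))); auto.
- intros y; apply (is_derive_minus (fun x => a * sinh x) (fun x => sinh (a * x))).
  + apply (is_derive_scal sinh y a), is_derive_sinh.
  + apply is_derive_sinh_scal.
- intros y Hy; pose proof (cosh_scal_le y (proj1 Hy)); nra.
- rewrite Rmult_0_r, sinh_0; lra.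
Qed.

(** Concavity of tanh, that is [a * tanh x <= tanh (a * x)], cleared of denominators. The mixed
    terms of the derivative cancel and leave a product of nonnegative factors. *)
Lemma sinh_cosh_scal_le (x : R) :
  0 <= x -> a * (sinh x * cosh (a * x)) <= sinh (a * x) * cosh x.
Proof.
intros Hx; apply Rminus_le_0.
apply (nonneg_of_derive (fun x => sinh (a * x) * cosh x - a * (sinh x * cosh (a * x)))
         (fun x => (1 - a * a) * (sinh x * sinh (a * x)))); auto.
- intros y.
  replace ((1 - a * a) * (sinh y * sinh (a * y))) with
    ((a * cosh (a * y)) * cosh y + sinh (a * y) * sinh y -
     a * (cosh y * cosh (a * y) + sinh y * (a * sinh (a * y)))) by ring.
  apply (is_derive_minus (fun x => sinh (a * x) * cosh x)
           (fun x => a * (sinh x * cosh (a * x)))).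
  + apply (is_derive_mult (fun x => sinh (a * x)) cosh);
      [apply is_derive_sinh_scal|apply is_derive_cosh|intros; apply Rmult_comm].
  + apply (is_derive_scal (fun x => sinh x * cosh (a * x))).
    apply (is_derive_mult sinh (fun x => cosh (a * x)));
      [apply is_derive_sinh|apply is_derive_cosh_scal|intros; apply Rmult_comm].
- intros y Hy.
  pose proof (sinh_nonneg y ltac:(lra)); pose proof (sinh_nonneg (a * y) ltac:(nra)).
  apply Rmult_le_pos; [nra|apply Rmult_le_pos; lra].
- rewrite Rmult_0_r, sinh_0; lra.
Qed.

(** Concavity of [sin] on [0, PI]; the derivative is nonnegative because [cos] decreases there. *)
Lemma sin_scal_ge (x : R) : 0 <= x <= PI -> a * sin x <= sin (a * x).
Proof.
intros Hx; apply Rminus_le_0.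
apply (nonneg_of_derive (fun x => sin (a * x) - a * sin x)
         (fun x => a * cos (a * x) - a * cos x)); try lra.
- intros y; auto_derive; [easy|ring].
- intros y Hy; pose proof (cos_decr_1 (a * y) y); nra.
- rewrite Rmult_0_r, sin_0; lra.
Qed.

(** Convexity of tan, that is [tan (a * x) <= a * tan x], cleared of denominators so that
    [x = PI / 2] is included. *)
Lemma sin_cos_scal_ge (x : R) :
  0 <= x <= PI / 2 -> cos x * sin (a * x) <= a * (sin x * cos (a * x)).
Proof.
intros Hx; apply Rminus_le_0.
apply (nonneg_of_derive (fun x => a * (sin x * cos (a * x)) - cos x * sin (a * x))
         (fun x => (1 - a * a) * (sin x * sin (a * x)))); try lra.
- intros y; auto_derive; [easy|ring].
- intros y Hy.
  pose proof (sin_ge_0 y ltac:(lra) ltac:(lra)).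
  pose proof (sin_ge_0 (a * y) ltac:(nra) ltac:(nra)).
  apply Rmult_le_pos; [nra|apply Rmult_le_pos; lra].
- rewrite Rmult_0_r, sin_0; lra.
Qed.

(** * The function [q] and its behaviour under scaling *)

(* Twice the product [r s] times [q (ln r - ln s) phi] is the squared distance between
   points of moduli [r], [s] whose arguments differ by [phi]. *)
Definition q (t phi : R) : R := cosh t - cos phi.

Lemma q_nonneg (t phi : R) : 0 <= q t phi.
Proof. unfold q; pose proof (cosh_ge_1 t); pose proof (COS_bound phi); lra. Qed.

(** Half-argument form: it turns [q] into a sum of squares, so that estimates for [sinh] and [sin]
    apply termwise. *)
Lemma q_double (t phi : R) :
  q (2 * t) (2 * phi) = 2 * (sinh t * sinh t + sin phi * sin phi).
Proof. unfold q; rewrite cosh_double, cos_2a_sin; ring. Qed.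

Lemma q_pi (t : R) : q (2 * t) PI = 2 * (cosh t * cosh t).
Proof. unfold q; rewrite cosh_double, cos_PI, cosh_sqr; ring. Qed.

(* At [t = 0] this is convexity of [tan]; its derivative in [t] is nonnegative by
   [sinh_scal_le] and [sin_scal_ge]. *)
Lemma q_log_derive_le (t phi : R) : 0 <= t -> 0 <= phi <= PI ->
  sin phi * q (a * t) (a * phi) <= a * sin (a * phi) * q t phi.
Proof.
intros Ht Hp; apply Rminus_le_0.
pose proof (sin_scal_ge phi Hp) as Hs.
pose proof (sin_ge_0 phi ltac:(lra) ltac:(lra)) as Hs0.
apply (nonneg_of_derive
         (fun t => a * sin (a * phi) * q t phi - sin phi * q (a * t) (a * phi))
         (fun t => a * sin (a * phi) * sinh t - sin phi * (a * sinh (a * t)))); auto.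
- intros y.
  apply (is_derive_minus (fun t => a * sin (a * phi) * q t phi)
           (fun t => sin phi * q (a * t) (a * phi))).
  + apply (is_derive_scal (fun t => q t phi)).
    rewrite <- (Rminus_0_r (sinh y)).
    apply (is_derive_minus cosh (fun _ => cos phi)); [apply is_derive_cosh|].
    auto_derive; easy.
  + apply (is_derive_scal (fun t => q (a * t) (a * phi))).
    rewrite <- (Rminus_0_r (a * sinh (a * y))).
    apply (is_derive_minus (fun t => cosh (a * t)) (fun _ => cos (a * phi)));
      [apply is_derive_cosh_scal|].
    auto_derive; easy.
- intros y Hy; pose proof (sinh_scal_le y (proj1 Hy)).
  pose proof (sinh_nonneg (a * y) ltac:(nra)).
  (* First [sinh (a * y) <= a * sinh y] makes [sinh (a * y)] a common factor; then
     [a * sin phi <= sin (a * phi)] gives the sign. *)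
  apply Rle_trans with (sin (a * phi) * sinh (a * y) - sin phi * (a * sinh (a * y))).
  + nra.
  + assert (0 <= sin (a * phi)) by nra; nra.
- rewrite Rmult_0_r.
  (* At [t = 0] half angles let a factor [4 * sin (phi / 2) * sin (a * phi / 2)] split off, leaving
     the inequality for tan. *)
  replace (q 0 phi) with (q (2 * 0) (2 * (phi / 2))) by (f_equal; lra).
  replace (q 0 (a * phi)) with (q (2 * 0) (2 * (a * (phi / 2)))) by (f_equal; lra).
  rewrite !q_double, sinh_0.
  replace (sin phi) with (sin (2 * (phi / 2))) by (f_equal; lra).
  replace (sin (a * phi)) with (sin (2 * (a * (phi / 2)))) by (f_equal; lra).
  rewrite !sin_2a.
  pose proof (sin_cos_scal_ge (phi / 2) ltac:(lra)).
  pose proof (sin_ge_0 (phi / 2) ltac:(lra) ltac:(lra)).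
  pose proof (sin_ge_0 (a * (phi / 2)) ltac:(nra) ltac:(nra)).
  match goal with |- 0 <= ?X => replace X with
   (4 * (sin (phi / 2) * sin (a * (phi / 2))) *
    (a * (sin (phi / 2) * cos (a * (phi / 2))) - cos (phi / 2) * sin (a * (phi / 2)))) by ring end.
  apply Rmult_le_pos; [|lra].
  apply Rmult_le_pos; [lra|apply Rmult_le_pos; lra].
Qed.

Lemma q_pos (t phi : R) : 0 < phi < 2 * PI -> 0 < q t phi.
Proof.
intros H; replace t with (2 * (t / 2)) by lra; replace phi with (2 * (phi / 2)) by lra.
rewrite q_double; pose proof (sin_gt_0 (phi / 2) ltac:(lra) ltac:(lra)); nra.
Qed.

(** The quotient [q t z / q (a * t) (a * z)] decreases in [z], since [q_log_derive_le] gives the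
    sign of its derivative. Positivity of the denominator at [phi] propagates to [phi, psi] because
    [cos] decreases. *)
Lemma q_scal_decr_aux (t phi psi : R) : 0 <= t -> 0 <= phi <= psi -> psi <= PI ->
  0 < q (a * t) (a * phi) ->
  q t psi * q (a * t) (a * phi) <= q t phi * q (a * t) (a * psi).
Proof.
intros Ht H1 H2 Hq.
assert (Hpos : forall z, phi <= z <= psi -> 0 < q (a * t) (a * z)).
{ intros z Hz; pose proof (cos_decr_1 (a * phi) (a * z)); unfold q in *; nra. }
destruct (MVT_gen (fun z => q t z / q (a * t) (a * z)) phi psi
  (fun z => (sin z * q (a * t) (a * z) - a * sin (a * z) * q t z) /
     (q (a * t) (a * z) * q (a * t) (a * z)))) as [c [Hc E]].
- rewrite Rmin_left, Rmax_right by lra; intros z Hz.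
  assert (0 < q (a * t) (a * z)) by (apply Hpos; lra).
  unfold q in *; auto_derive; [lra|field; lra].
- rewrite Rmin_left, Rmax_right by lra; intros z Hz.
  assert (0 < q (a * t) (a * z)) by (apply Hpos; lra).
  apply continuity_pt_filterlim, (ex_derive_continuous (fun z => q t z / q (a * t) (a * z)) z).
  unfold q in *; auto_derive; lra.
- rewrite Rmin_left, Rmax_right in Hc by lra.
  pose proof (q_log_derive_le t c Ht ltac:(lra)) as Hd.
  pose proof (Hpos c Hc) as Hpc; pose proof (Hpos psi ltac:(lra)) as Hpp.
  assert (Hle : q t psi / q (a * t) (a * psi) <= q t phi / q (a * t) (a * phi)).
  { assert (Hi : 0 < / (q (a * t) (a * c) * q (a * t) (a * c)))
      by (apply Rinv_0_lt_compat; nra).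
    unfold Rdiv at 3 in E.
    assert ((sin c * q (a * t) (a * c) - a * sin (a * c) * q t c) *
            / (q (a * t) (a * c) * q (a * t) (a * c)) <= 0) by nra.
    nra. }
  apply (Rmult_le_compat_r (q (a * t) (a * psi) * q (a * t) (a * phi))) in Hle; [|nra].
  field_simplify in Hle; [nra|lra|lra].
Qed.

(** Evenness in [t] reduces to [t >= 0]; if the denominator at [phi] vanishes, the left side is
    0. *)
Lemma q_scal_decr (t phi psi : R) : 0 <= phi <= psi -> psi <= PI ->
  q t psi * q (a * t) (a * phi) <= q t phi * q (a * t) (a * psi).
Proof.
intros H1 H2.
assert (Heq : forall s z, q s z = q (Rabs s) z) by (intros; unfold q; now rewrite cosh_Rabs).
rewrite !(Heq t), !(Heq (a * t)), Rabs_mult, (Rabs_pos_eq a) by lra.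
destruct (q_nonneg (a * Rabs t) (a * phi)) as [H|H].
- apply q_scal_decr_aux; auto using Rabs_pos.
- rewrite <- H, Rmult_0_r; apply Rmult_le_pos; apply q_nonneg.
Qed.

(** The extreme case [a * sigma = PI]. In half arguments the claim is [a^2 (S^2 + p^2) C'^2 <= (S'^2
    + p'^2) C^2], proved termwise: the [S] terms by concavity of tanh, the [p] terms by concavity of
    [sin] and [C' <= C]. *)
Lemma q_scal_pi_le (t phi : R) : 0 <= phi <= PI ->
  a * a * (q t phi * q (a * t) PI) <= q (a * t) (a * phi) * q t PI.
Proof.
intros Hp.
assert (Heq : forall s z, q s z = q (Rabs s) z) by (intros; unfold q; now rewrite cosh_Rabs).
rewrite !(Heq t), !(Heq (a * t)), Rabs_mult, (Rabs_pos_eq a) by lra.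
pose proof (Rabs_pos t) as Ht; revert Ht; generalize (Rabs t); clear t; intros t Ht.
replace (q t phi) with (q (2 * (t / 2)) (2 * (phi / 2))) by (f_equal; lra).
replace (q (a * t) (a * phi)) with (q (2 * (a * (t / 2))) (2 * (a * (phi / 2)))) by (f_equal; lra).
replace (q t PI) with (q (2 * (t / 2)) PI) by (f_equal; lra).
replace (q (a * t) PI) with (q (2 * (a * (t / 2))) PI) by (f_equal; lra).
rewrite !q_double, !q_pi.
pose proof (sinh_cosh_scal_le (t / 2) ltac:(lra)) as H1.
pose proof (sin_scal_ge (phi / 2) ltac:(lra)) as H2.
pose proof (cosh_scal_le (t / 2) ltac:(lra)) as H3.
pose proof (sin_ge_0 (phi / 2) ltac:(lra) ltac:(lra)).
pose proof (sinh_nonneg (t / 2) ltac:(lra)).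
pose proof (cosh_ge_1 (t / 2)); pose proof (cosh_ge_1 (a * (t / 2))).
set (S := sinh (t / 2)) in *; set (C := cosh (t / 2)) in *.
set (S' := sinh (a * (t / 2))) in *; set (C' := cosh (a * (t / 2))) in *.
set (p := sin (phi / 2)) in *; set (p' := sin (a * (phi / 2))) in *.
assert (0 <= a * (S * C')) by (apply Rmult_le_pos; [|apply Rmult_le_pos]; lra).
assert ((a * (S * C')) * (a * (S * C')) <= (S' * C) * (S' * C))
  by (apply Rmult_le_compat; lra).
assert (0 <= a * p) by (apply Rmult_le_pos; lra).
assert ((a * p) * C' <= p' * C) by (apply Rmult_le_compat; lra).
assert (((a * p) * C') * ((a * p) * C') <= (p' * C) * (p' * C)).
{ apply Rmult_le_compat; try lra; apply Rmult_le_pos; lra. }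
nra.
Qed.

Lemma q_incr (t phi psi : R) : 0 <= phi <= psi -> psi <= PI -> q t phi <= q t psi.
Proof. intros; unfold q; pose proof (cos_decr_1 phi psi); lra. Qed.

(** The squared upper bound, cross-multiplied. Up to PI it is the monotone quotient; beyond PI the
    unscaled [q] is frozen at PI while the scaled one keeps increasing. *)
Lemma q_upper (t delta sigma : R) : 0 <= delta <= sigma -> a * sigma <= PI ->
  q (a * t) (a * delta) * q t (Rmin sigma PI) <=
  q t (Rmin delta PI) * q (a * t) (a * sigma).
Proof.
intros H1 H2; pose proof PI_RGT_0.
unfold Rmin; destruct (Rle_dec sigma PI), (Rle_dec delta PI); try lra.
- rewrite Rmult_comm; apply q_scal_decr; lra.
- pose proof (q_scal_decr t delta PI ltac:(lra) ltac:(lra)).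
  pose proof (q_scal_decr t delta PI ltac:(lra) ltac:(lra)).
  pose proof (q_incr (a * t) (a * PI) (a * sigma) ltac:(nra) ltac:(nra)).
  pose proof (q_nonneg t delta); nra.
- rewrite Rmult_comm; apply Rmult_le_compat_l; [apply q_nonneg|].
  apply q_incr; nra.
Qed.

Lemma q_lower (t delta sigma : R) : 0 <= delta <= sigma -> a * sigma <= PI ->
  a * a * (q t (Rmin delta PI) * q (a * t) (a * sigma)) <=
  q (a * t) (a * delta) * q t (Rmin sigma PI).
Proof.
intros H1 H2; pose proof PI_RGT_0 as Hpi.
(* [HG] replaces [sigma] by the extreme value, where the ratio of scaled to unscaled [q] is
   largest. *)
assert (HG : q t PI * q (a * t) (a * sigma) <= q t (Rmin sigma PI) * q (a * t) PI).
{ unfold Rmin; destruct (Rle_dec sigma PI).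
  - apply Rle_trans with (q t sigma * q (a * t) (a * PI)).
    + apply q_scal_decr; lra.
    + apply Rmult_le_compat_l; [apply q_nonneg|apply q_incr; nra].
  - apply Rmult_le_compat_l; [apply q_nonneg|apply q_incr; nra]. }
(* [HF] is the bound in the extreme case; a [delta] beyond PI is compared with PI. *)
assert (HF : a * a * (q t (Rmin delta PI) * q (a * t) PI) <= q (a * t) (a * delta) * q t PI).
{ unfold Rmin; destruct (Rle_dec delta PI).
  - apply q_scal_pi_le; lra.
  - eapply Rle_trans; [apply q_scal_pi_le; lra|].
    apply Rmult_le_compat_r; [apply q_nonneg|apply q_incr; nra]. }
pose proof (q_pos t PI ltac:(lra)) as P1; pose proof (q_pos (a * t) PI ltac:(lra)) as P2.
(* The product of [HG] and [HF] is the goal times this positive common factor. *)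
apply (Rmult_le_reg_r (q t PI * q (a * t) PI)); [nra|].
pose proof (q_nonneg t (Rmin delta PI)); pose proof (q_nonneg (a * t) (a * sigma)).
pose proof (q_nonneg t (Rmin sigma PI)); pose proof (q_nonneg (a * t) (a * delta)).
assert (0 <= a * a) by nra.
assert (HM := Rmult_le_compat _ _ _ _
  (Rmult_le_pos _ _ (Rlt_le _ _ P1) (q_nonneg (a * t) (a * sigma)))
  (Rmult_le_pos _ _ H5 (Rmult_le_pos _ _ H (Rlt_le _ _ P2))) HG HF).
lra.
Qed.
End Scaling.

(** * Polar coordinates *)

Lemma cos_sin_inj (phi psi : R) : 0 <= phi < 2 * PI -> 0 <= psi < 2 * PI ->
  cos phi = cos psi -> sin phi = sin psi -> phi = psi.
Proof.
intros H1 H2 Hc Hs.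
assert (H : cos (2 * ((phi - psi) / 2)) = 1).
{ replace (2 * ((phi - psi) / 2)) with (phi - psi) by lra.
  rewrite cos_minus, Hc, Hs; pose proof (sin2_cos2 psi); unfold Rsqr in *; lra. }
rewrite cos_2a_sin in H.
destruct (Rtotal_order phi psi) as [L|[E|L]]; auto.
- pose proof (sin_gt_0 ((psi - phi) / 2) ltac:(lra) ltac:(lra)) as Hp.
  replace ((psi - phi) / 2) with (- ((phi - psi) / 2)) in Hp by lra.
  rewrite sin_neg in Hp; nra.
- pose proof (sin_gt_0 ((phi - psi) / 2) ltac:(lra) ltac:(lra)); nra.
Qed.

Lemma Cmod_polar (r phi : R) : 0 <= r -> Cmod (polar r phi) = r.
Proof.
intros Hr; unfold Cmod, polar; simpl.
replace (_ + _) with (r ^ 2).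
- apply sqrt_pow2, Hr.
- pose proof (sin2_cos2 phi) as H; unfold Rsqr in H.
  replace (r ^ 2) with (r ^ 2 * (sin phi * sin phi + cos phi * cos phi)) by (rewrite H; ring).
  ring.
Qed.

Lemma polar_exists (z : C) : exists phi, 0 <= phi < 2 * PI /\ z = polar (Cmod z) phi.
Proof.
pose proof PI_RGT_0 as Hpi.
destruct (Ceq_dec z 0) as [E|E].
{ exists 0; split; [lra|]. rewrite E, Cmod_0; unfold polar.
  apply injective_projections; simpl; ring. }
assert (Hz : 0 < Cmod z) by now apply Cmod_gt_0.
destruct z as [x y]; set (r := Cmod (x, y)) in *.
assert (Hr : r * r = x * x + y * y).
{ unfold r, Cmod; simpl fst; simpl snd; rewrite sqrt_sqrt; [ring|nra]. }
assert (Hx : -1 <= x / r <= 1).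
{ split; apply (Rmult_le_reg_r r); auto; field_simplify; try lra; nra. }
pose proof (acos_bound (x / r)) as Hb.
pose proof (cos_acos _ Hx) as Hc.
assert (Hs : r * sin (acos (x / r)) = Rabs y).
{ rewrite sin_acos by auto.
  replace (1 - (x / r)²) with ((Rabs y / r)²).
  - rewrite sqrt_Rsqr; [field; lra|].
    apply Rmult_le_pos; [apply Rabs_pos|]; left; now apply Rinv_0_lt_compat.
  - rewrite !Rsqr_div', <- Rsqr_abs; unfold Rsqr; rewrite Hr; field; nra. }
destruct (Rle_dec 0 y) as [Hy|Hy].
- exists (acos (x / r)); split; [lra|].
  unfold polar; rewrite Hs, Hc, Rabs_pos_eq by auto; f_equal; field; lra.
- exists (2 * PI - acos (x / r)).
  (* A zero here would give the angle [2 * PI], outside the half-open range; [y < 0] excludes it. *)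
  assert (acos (x / r) <> 0).
  { intros H; rewrite H, sin_0, Rabs_left in Hs; lra. }
  split; [lra|].
  assert (Ec : cos (2 * PI - acos (x / r)) = x / r)
    by (rewrite cos_minus, cos_2PI, sin_2PI, Hc; ring).
  assert (Es : sin (2 * PI - acos (x / r)) = - sin (acos (x / r)))
    by (rewrite sin_minus, cos_2PI, sin_2PI; ring).
  unfold polar; rewrite Ec, Es.
  rewrite Rabs_left in Hs by lra.
  f_equal; [field; lra|lra].
Qed.

Lemma arg_spec (z : C) : 0 <= arg z < 2 * PI /\ z = polar (Cmod z) (arg z).
Proof.
apply (epsilon_spec (inhabits 0) (fun phi => 0 <= phi < 2 * PI /\ z = polar (Cmod z) phi)).
apply polar_exists.
Qed.

Lemma arg_polar (r phi : R) : 0 < r -> 0 <= phi < 2 * PI -> arg (polar r phi) = phi.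
Proof.
intros Hr Hp; destruct (arg_spec (polar r phi)) as [H1 H2].
rewrite Cmod_polar in H2 by lra.
unfold polar in H2 at 1; injection H2 as E1 E2.
apply Rmult_eq_reg_l in E1, E2; try lra.
symmetry; now apply cos_sin_inj.
Qed.

Lemma polar_neq_0 (r phi : R) : 0 < r -> polar r phi <> 0%C.
Proof. intros Hr E; pose proof (Cmod_polar r phi) as H; rewrite E, Cmod_0 in H; lra. Qed.

Lemma sector_polar (theta r phi : R) : theta < 2 * PI -> 0 < r -> 0 < phi < theta ->
  sector theta (polar r phi).
Proof.
intros Ht Hr Hp; split; [now apply polar_neq_0|].
rewrite arg_polar; lra.
Qed.

Lemma sector_polar_inv (theta : R) (z : C) : sector theta z ->
  exists r phi, 0 < r /\ 0 < phi < theta /\ z = polar r phi.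
Proof.
intros [H0 Ha]; exists (Cmod z), (arg z); repeat split; try lra.
- now apply Cmod_gt_0.
- apply arg_spec.
Qed.

Lemma cpow_polar (r phi a : R) : 0 < r -> 0 <= phi < 2 * PI ->
  cpow (polar r phi) a = polar (Rpower r a) (a * phi).
Proof. intros; unfold cpow; rewrite arg_polar, Cmod_polar by lra; easy. Qed.

(* Third side of a triangle with sides [r], [s] and enclosed angle [phi]. *)
Definition side (r s phi : R) : R := sqrt (r * r + s * s - 2 * r * s * cos phi).

Lemma Cmod_polar_minus (r s phi psi : R) :
  Cmod (polar r phi - polar s psi) = side r s (phi - psi).
Proof.
unfold Cmod, side, polar; f_equal; simpl.
rewrite cos_minus.
pose proof (sin2_cos2 phi) as H1; pose proof (sin2_cos2 psi) as H2; unfold Rsqr in *.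
replace (r * r) with (r * r * (sin phi * sin phi + cos phi * cos phi)) by (rewrite H1; ring).
replace (s * s) with (s * s * (sin psi * sin psi + cos psi * cos psi)) by (rewrite H2; ring).
ring.
Qed.

Lemma side_cos (r s phi psi : R) : cos phi = cos psi -> side r s phi = side r s psi.
Proof. intros H; unfold side; now rewrite H. Qed.

Lemma side_opp (r s phi : R) : side r s (- phi) = side r s phi.
Proof. apply side_cos, cos_neg. Qed.

Lemma side_pi (r s : R) : 0 <= r -> 0 <= s -> side r s PI = r + s.
Proof.
intros; unfold side; rewrite cos_PI.
replace (_ - _) with ((r + s) * (r + s)) by ring; apply sqrt_square; lra.
Qed.

Lemma side_incr (r s phi psi : R) : 0 <= r -> 0 <= s -> 0 <= phi <= psi -> psi <= PI ->
  side r s phi <= side r s psi.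
Proof.
intros; unfold side; apply sqrt_le_1_alt.
pose proof (cos_decr_1 phi psi ltac:(lra) ltac:(lra) ltac:(lra) ltac:(lra) ltac:(lra)).
assert (0 <= r * s) by now apply Rmult_le_pos.
nra.
Qed.

Lemma side_triangle (r s rho phi psi : R) :
  side r s (phi + psi) <= side r rho phi + side rho s psi.
Proof.
replace (phi + psi) with (phi - - psi) by ring.
rewrite <- Cmod_polar_minus.
replace phi with (phi - 0) at 2 by ring; rewrite <- Cmod_polar_minus.
replace psi with (0 - - psi) at 2 by ring; rewrite <- Cmod_polar_minus.
replace (polar r phi - polar s (- psi))%C with
  ((polar r phi - polar rho 0) + (polar rho 0 - polar s (- psi)))%C by ring.
apply Cmod_triangle.
Qed.

(** Lower bound for a path through an intermediate point: split [chi] into [Rmin phi chi] and a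
    remainder of at most [psi], then use the triangle inequality and monotonicity in the angle. *)
Lemma side_detour (r s rho phi psi chi : R) : 0 <= r -> 0 <= s -> 0 <= rho ->
  0 <= phi <= PI -> 0 <= psi <= PI -> 0 <= chi <= PI -> chi <= phi + psi ->
  side r s chi <= side r rho phi + side rho s psi.
Proof.
intros Hr Hs Hrho H1 H2 H3 H4.
pose proof (Rmin_l phi chi); pose proof (Rmin_r phi chi).
assert (0 <= Rmin phi chi) by (apply Rmin_glb; lra).
assert (chi - Rmin phi chi <= psi) by (unfold Rmin; destruct Rle_dec; lra).
replace chi with (Rmin phi chi + (chi - Rmin phi chi)) at 1 by ring.
eapply Rle_trans; [apply side_triangle|].
apply Rplus_le_compat; apply side_incr; try eassumption; lra.
Qed.

(* [rho] is where the segment joining the two outer vertices meets the ray between them. *)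
Lemma side_detour_attained (r s phi psi : R) : 0 < r -> 0 < s -> 0 < phi -> 0 < psi ->
  phi + psi <= PI ->
  exists rho, 0 <= rho /\ side r rho phi + side rho s psi = side r s (phi + psi).
Proof.
intros Hr Hs Hp Hq Hpq.
pose proof (sin_gt_0 phi ltac:(lra) ltac:(lra)) as S1.
pose proof (sin_gt_0 psi ltac:(lra) ltac:(lra)) as S2.
pose proof (sin_ge_0 (phi + psi) ltac:(lra) ltac:(lra)) as S3.
assert (HA : 0 < r * sin phi) by now apply Rmult_lt_0_compat.
assert (HB : 0 < s * sin psi) by now apply Rmult_lt_0_compat.
set (D := r * sin phi + s * sin psi) in *.
assert (HD : 0 < D) by (unfold D; lra).
assert (Hrs : 0 < r * s) by now apply Rmult_lt_0_compat.
(* Comparing areas of the two partial triangles with the whole one gives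
   [rho * D = r * s * sin (phi + psi)]. *)
exists (r * s * sin (phi + psi) / D); split.
{ apply Rmult_le_pos; [nra|left; now apply Rinv_0_lt_compat]. }
assert (Hk : forall k z, 0 <= k -> Cmod (RtoC k * z) = k * Cmod z).
{ intros k z Hk; now rewrite Cmod_mult, Cmod_R, Rabs_pos_eq. }
assert (Hi : 0 <= / D) by (left; now apply Rinv_0_lt_compat).
set (rho := r * s * sin (phi + psi) / D).
replace phi with (phi - 0) at 1 by ring; rewrite <- Cmod_polar_minus.
replace psi with (0 - - psi) at 1 by ring; rewrite <- Cmod_polar_minus.
replace (phi + psi) with (phi - - psi) by ring; rewrite <- Cmod_polar_minus.
(* Both pieces are multiples of the whole segment, with nonnegative weights that sum to 1. *)
replace (polar r phi - polar rho 0)%C with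
  (RtoC (r * sin phi / D) * (polar r phi - polar s (- psi)))%C.
2: { unfold rho, polar; rewrite sin_plus, cos_neg, sin_neg, cos_0, sin_0.
  apply injective_projections; simpl; unfold D; field; fold D; lra. }
replace (polar rho 0 - polar s (- psi))%C with
  (RtoC (s * sin psi / D) * (polar r phi - polar s (- psi)))%C.
2: { unfold rho, polar; rewrite sin_plus, cos_neg, sin_neg, cos_0, sin_0.
  apply injective_projections; simpl; unfold D; field; fold D; lra. }
rewrite !Hk by (apply Rmult_le_pos; lra).
rewrite <- Rmult_plus_distr_r, <- Rdiv_plus_distr; fold D.
field; lra.
Qed.

(** * Half-planes, interiors, closures and attained infima *)

(** Cauchy-Schwarz for the unit vector [(p, k)]; the gap between the squares is the square of the
    orthogonal component. *)
Lemma Cmod_linear_bound (p k : R) (z : C) : p * p + k * k = 1 ->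
  Rabs (p * fst z + k * snd z) <= Cmod z.
Proof.
intros H; unfold Cmod; rewrite <- sqrt_Rsqr_abs; apply sqrt_le_1_alt.
pose proof (Rle_0_sqr (p * snd z - k * fst z)); unfold Rsqr in *.
replace (fst z ^ 2 + snd z ^ 2) with ((fst z ^ 2 + snd z ^ 2) * (p * p + k * k))
  by (rewrite H; ring).
nra.
Qed.

Lemma interior_of_halfplane (G : C -> Prop) (p k : R) (z : C) : p * p + k * k = 1 ->
  (forall w, 0 < p * fst w + k * snd w -> G w) ->
  0 < p * fst z + k * snd z -> interior_C G z.
Proof.
intros H HG Hz; exists (p * fst z + k * snd z); split; auto.
intros w Hw; apply HG.
pose proof (Cmod_linear_bound p k (w - z)%C H) as B; simpl in B.
apply Rabs_le_between in B; lra.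
Qed.

Lemma closure_of_halfplane (G : C -> Prop) (p k : R) (z : C) : p * p + k * k = 1 ->
  (forall w, 0 < p * fst w + k * snd w -> G w) ->
  p * fst z + k * snd z = 0 -> closure_C G z.
Proof.
intros H HG Hz eps He; exists (z + RtoC (eps / 2) * (p, k))%C; split.
- apply HG; simpl.
  replace (_ + _) with (p * fst z + k * snd z + eps / 2 * (p * p + k * k)) by field.
  rewrite Hz, H; lra.
- replace (_ - _)%C with (RtoC (eps / 2) * (p, k))%C by ring.
  rewrite Cmod_mult, Cmod_R, Rabs_pos_eq by lra.
  unfold Cmod; simpl fst; simpl snd.
  replace (p ^ 2 + k ^ 2) with 1 by (rewrite <- H; ring).
  rewrite sqrt_1; lra.
Qed.

Lemma Glb_Rbar_min (E : R -> Prop) (m : R) : E m -> (forall t, E t -> m <= t) ->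
  real (Glb_Rbar E) = m.
Proof.
intros H1 H2; rewrite (is_glb_Rbar_unique E m); [easy|].
split; [intros t Ht; now apply H2|intros b Hb; now apply Hb].
Qed.

(** * The sector and its boundary *)

Section Sector.
Variable theta : R.
Hypothesis Htheta : PI < theta < 2 * PI.

(* Since [theta > PI], the sector is the union of two open half-planes. *)
Lemma sector_halfplanes (z : C) :
  sector theta z <-> 0 < snd z \/ 0 < sin theta * fst z - cos theta * snd z.
Proof.
destruct (Ceq_dec z 0) as [E|E].
{ rewrite E; split; [now intros [H _]|simpl; lra]. }
assert (Hr : 0 < Cmod z) by now apply Cmod_gt_0.
destruct (arg_spec z) as [Ha Ez]; unfold sector.
revert Ha Ez; generalize (arg z) as phi; intros phi Ha Ez.
assert (E1 : snd z = Cmod z * sin phi) by (rewrite Ez at 1; easy).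
assert (E2 : sin theta * fst z - cos theta * snd z = Cmod z * sin (theta - phi)).
{ rewrite E1; replace (fst z) with (Cmod z * cos phi) by (rewrite Ez at 2; easy).
  rewrite sin_minus; ring. }
rewrite E2, E1.
assert (Hpos : forall u, 0 < Cmod z * u <-> 0 < u).
{ intros u; split; intros; [apply (Rmult_lt_reg_l (Cmod z)); lra|now apply Rmult_lt_0_compat]. }
rewrite !Hpos; split.
- intros [_ H]; destruct (Rlt_dec phi PI) as [L|L].
  + left; apply sin_gt_0; lra.
  + right; apply sin_gt_0; lra.
- intros H; split; auto.
  destruct (Rle_dec theta phi) as [L|L].
  + pose proof (sin_le_0 phi ltac:(lra) ltac:(lra)).
    pose proof (sin_ge_0 (phi - theta) ltac:(lra) ltac:(lra)) as H1.
    replace (phi - theta) with (- (theta - phi)) in H1 by ring.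
    rewrite sin_neg in H1; lra.
  + split; [|lra].
    destruct (proj1 Ha) as [|<-]; auto.
    rewrite sin_0, Rminus_0_r in H.
    pose proof (sin_lt_0 theta ltac:(lra) ltac:(lra)); lra.
Qed.

Lemma boundary_sector (z : C) : boundary_C (sector theta) z <->
  exists rho, 0 <= rho /\ (z = polar rho 0 \/ z = polar rho theta).
Proof.
pose proof (sin_lt_0 theta ltac:(lra) ltac:(lra)) as Hs.
pose proof (sin2_cos2 theta) as Hsc; unfold Rsqr in Hsc.
assert (G1 : forall w, 0 < 0 * fst w + 1 * snd w -> sector theta w)
  by (intros w H; apply sector_halfplanes; lra).
assert (G2 : forall w, 0 < sin theta * fst w + - cos theta * snd w -> sector theta w)
  by (intros w H; apply sector_halfplanes; lra).
assert (Hint : ~ sector theta z -> ~ interior_C (sector theta) z).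
{ intros Hn [eps [He H]]; apply Hn, H.
  replace (z - z)%C with (RtoC 0) by ring; now rewrite Cmod_0. }
split.
- intros [Hc Hi].
  assert (H1 : snd z <= 0).
  { apply Rnot_lt_le; intros H; apply Hi.
    apply (interior_of_halfplane _ 0 1); auto; lra. }
  assert (H2 : sin theta * fst z + - cos theta * snd z <= 0).
  { apply Rnot_lt_le; intros H; apply Hi.
    apply (interior_of_halfplane _ (sin theta) (- cos theta)); auto; lra. }
  (* If both forms were negative, a disc about [z] with the smaller absolute value as radius would
     miss both half-planes, although [z] lies in the closure. *)
  assert (H3 : snd z = 0 \/ sin theta * fst z + - cos theta * snd z = 0).
  { apply NNPP; intros Hn; apply not_or_and in Hn; destruct Hn as [N1 N2].
    set (L := sin theta * fst z + - cos theta * snd z) in *.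
    destruct (Hc (Rmin (- snd z) (- L))) as [w [Hw Hd]].
    { apply Rmin_glb_lt; lra. }
    pose proof (Rmin_l (- snd z) (- L)); pose proof (Rmin_r (- snd z) (- L)).
    apply sector_halfplanes in Hw.
    pose proof (Cmod_linear_bound 0 1 (w - z)%C ltac:(lra)) as B1.
    pose proof (Cmod_linear_bound (sin theta) (- cos theta) (w - z)%C ltac:(lra)) as B2.
    simpl in B1, B2; apply Rabs_le_between in B1, B2; unfold L in *; lra. }
  destruct H3 as [H3|H3].
  + exists (fst z); split; [nra|left].
    apply injective_projections; simpl; rewrite ?cos_0, ?sin_0; lra.
  + exists (snd z / sin theta); split.
    { replace (snd z / sin theta) with (- snd z / - sin theta) by (field; lra).
      apply Rdiv_le_0_compat; lra. }
    right; apply injective_projections; simpl; [|field; lra].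
    apply (Rmult_eq_reg_l (sin theta)); [|lra]. field_simplify; lra.
- intros [rho [Hr [-> | ->]]]; split.
  + apply (closure_of_halfplane _ 0 1); auto; simpl; rewrite ?sin_0; lra.
  + apply Hint; rewrite sector_halfplanes; simpl; rewrite cos_0, sin_0; nra.
  + apply (closure_of_halfplane _ (sin theta) (- cos theta)); auto; simpl; lra.
  + apply Hint; rewrite sector_halfplanes; simpl; nra.
Qed.

(** If [|phi - psi| > PI], the segment itself crosses the boundary. Otherwise reflection in the ray
    of angle 0 or [theta] opens the path to the angle [phi + psi] or [2 * theta - (phi + psi)] at
    the vertex; once the smaller exceeds PI, the path through the vertex is shortest, hence the
    cap. *)
Lemma boundary_path_min (r s phi psi : R) : 0 < r -> 0 < s ->
  0 < phi < theta -> 0 < psi < theta ->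
  real (Glb_Rbar (fun t => exists z, boundary_C (sector theta) z /\
    t = Cmod (polar r phi - z) + Cmod (z - polar s psi))) =
  if Rle_dec (Rabs (phi - psi)) PI
  then side r s (Rmin (Rmin (phi + psi) (2 * theta - (phi + psi))) PI)
  else side r s (phi - psi).
Proof.
intros Hr Hs H1 H2; apply Glb_Rbar_min.
(* Angles to the ray enter only through their cosines, so [2 * PI - psi] may stand for [psi] when
   the ray is approached from its other side. *)
- assert (HA : forall A B, cos A = cos phi -> cos B = cos psi -> 0 < A -> 0 < B -> A + B <= PI ->
    exists z, boundary_C (sector theta) z /\
    side r s (A + B) = Cmod (polar r phi - z) + Cmod (z - polar s psi)).
  { intros A B EA EB HA HB HAB.
    destruct (side_detour_attained r s A B) as [rho [Hrho E]]; auto.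
    exists (polar rho 0); split; [apply boundary_sector; eauto|].
    rewrite !Cmod_polar_minus, <- E; f_equal; apply side_cos.
    - now rewrite Rminus_0_r.
    - rewrite Rminus_0_l, cos_neg; easy. }
  assert (HB : forall A B, cos A = cos (theta - phi) -> cos B = cos (theta - psi) ->
    0 < A -> 0 < B -> A + B <= PI ->
    exists z, boundary_C (sector theta) z /\
    side r s (A + B) = Cmod (polar r phi - z) + Cmod (z - polar s psi)).
  { intros A B EA EB HA' HB HAB.
    destruct (side_detour_attained r s A B) as [rho [Hrho E]]; auto.
    exists (polar rho theta); split; [apply boundary_sector; eauto|].
    rewrite !Cmod_polar_minus, <- E; f_equal; apply side_cos; auto.
    rewrite EA, <- cos_neg; f_equal; ring. }
  assert (Hcos : forall x, cos (2 * PI - x) = cos x)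
    by (intros; rewrite cos_minus, cos_2PI, sin_2PI; ring).
  destruct Rle_dec as [L|L].
  + unfold Rmin; destruct (Rle_dec (phi + psi) (2 * theta - (phi + psi)));
      destruct Rle_dec.
    * apply HA; auto; lra.
    (* Here the cap is active: the boundary point is the vertex and the length is [r + s]. *)
    * exists (polar 0 0); split; [apply boundary_sector; exists 0; auto with real|].
      rewrite !Cmod_polar_minus, side_pi by lra.
      unfold side; rewrite !Rmult_0_r, !Rmult_0_l, Rminus_0_r, Rplus_0_r, Rplus_0_l, Rminus_0_r.
      rewrite !sqrt_square; lra.
    * replace (2 * theta - (phi + psi)) with ((theta - phi) + (theta - psi)) by ring.
      apply HB; auto; lra.
    * exists (polar 0 0); split; [apply boundary_sector; exists 0; auto with real|].
      rewrite !Cmod_polar_minus, side_pi by lra.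
      unfold side; rewrite !Rmult_0_r, !Rmult_0_l, Rminus_0_r, Rplus_0_r, Rplus_0_l, Rminus_0_r.
      rewrite !sqrt_square; lra.
  (* The angle [2 * PI - |phi - psi|], less than PI, contains the ray of angle 0, so the segment
     meets that ray. *)
  + unfold Rabs in L; destruct (Rcase_abs (phi - psi)).
    * rewrite (side_cos _ _ (phi - psi) (phi + (2 * PI - psi))).
      -- apply HA; auto; lra.
      -- rewrite <- (cos_neg (phi - psi)), <- Hcos; f_equal; ring.
    * rewrite (side_cos _ _ (phi - psi) ((2 * PI - phi) + psi)).
      -- apply HA; auto; lra.
      -- rewrite <- Hcos; f_equal; ring.
- intros t [z [Hz ->]]; apply boundary_sector in Hz.
  destruct Rle_dec as [L|L].
  + set (chi := Rmin _ PI).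
    assert (0 <= chi <= PI /\ chi <= phi + psi /\ chi <= 2 * theta - (phi + psi)).
    { pose proof (Rmin_l (Rmin (phi + psi) (2 * theta - (phi + psi))) PI).
      pose proof (Rmin_r (Rmin (phi + psi) (2 * theta - (phi + psi))) PI).
      pose proof (Rmin_l (phi + psi) (2 * theta - (phi + psi))).
      pose proof (Rmin_r (phi + psi) (2 * theta - (phi + psi))).
      fold chi in H, H0; repeat split; try lra.
      unfold chi; repeat apply Rmin_glb; lra. }
    assert (HF : forall x, 0 < x < 2 * PI -> exists y,
      0 <= y <= PI /\ cos y = cos x /\ (y = x \/ PI < x /\ y = 2 * PI - x)).
    { intros x Hx; destruct (Rle_dec x PI).
      - exists x; repeat split; auto; lra.
      - exists (2 * PI - x); repeat split; try lra.
        rewrite cos_minus, cos_2PI, sin_2PI; ring. }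
    assert (HL : - PI <= phi - psi <= PI) by now apply Rabs_le_between.
    (* [A] and [B] are the angles of the endpoints to either ray, folded into [0, PI] by [HF]. With
       no fold or two folds the sum is bounded by [C1] or [C2]; with one fold it is at least PI by
       [HAB]. *)
    assert (HD : forall A B rho, 0 <= rho -> 0 < A < 2 * PI -> 0 < B < 2 * PI ->
      - PI <= A - B <= PI -> chi <= A + B -> chi <= 4 * PI - (A + B) ->
      side r s chi <= side r rho A + side rho s B).
    { intros A B rho Hrho HA HB HAB C1 C2.
      destruct (HF A HA) as [A' [HA' [EA DA]]]; destruct (HF B HB) as [B' [HB' [EB DB]]].
      rewrite <- (side_cos r rho A' A), <- (side_cos rho s B' B) by auto.
      apply side_detour; lra. }
    destruct Hz as [rho [Hrho [-> | ->]]]; rewrite !Cmod_polar_minus.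
    * rewrite Rminus_0_r, Rminus_0_l, side_opp; apply HD; lra.
    * rewrite <- (side_opp r rho); apply HD; lra.
  + rewrite <- Cmod_polar_minus.
    replace (polar r phi - polar s psi)%C with
      ((polar r phi - z) + (z - polar s psi))%C by ring.
    apply Cmod_triangle.
Qed.
End Sector.

(** * The two metrics on the sector *)

Lemma side_ratio (r s phi psi : R) : 0 < r -> 0 < s -> 0 < q (ln r - ln s) psi ->
  side r s phi / side r s psi = sqrt (q (ln r - ln s) phi / q (ln r - ln s) psi).
Proof.
intros Hr Hs Hq.
assert (E : forall x, side r s x = sqrt (2 * r * s) * sqrt (q (ln r - ln s) x)).
{ intros x; rewrite <- sqrt_mult_alt by (left; repeat apply Rmult_lt_0_compat; lra).
  unfold side, q, cosh; f_equal.
  replace (- (ln r - ln s)) with (ln s + - ln r) by ring.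
  unfold Rminus at 3; rewrite !exp_plus, !exp_Ropp, !exp_ln by auto.
  field; lra. }
assert (0 < sqrt (2 * r * s)) by (apply sqrt_lt_R0; repeat apply Rmult_lt_0_compat; lra).
pose proof (sqrt_lt_R0 _ Hq).
rewrite !E, sqrt_div_alt by auto; field; lra.
Qed.

Lemma th_artanh (k : R) : -1 < k < 1 -> th (artanh k) = k.
Proof.
intros Hk; unfold th, artanh; rewrite exp_Ropp.
set (E := exp _); assert (HE : 0 < E) by apply exp_pos.
assert (H : E * E = (1 + k) / (1 - k)).
{ unfold E; rewrite <- exp_plus.
  replace (_ + _) with (ln ((1 + k) / (1 - k))) by field.
  apply exp_ln, Rdiv_lt_0_compat; lra. }
replace ((E - / E) / (E + / E)) with ((E * E - 1) / (E * E + 1)) by (field; nra).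
rewrite H; field; lra.
Qed.

(* If [|phi - psi| >= PI] the segment meets the boundary, both minima are [PI] and the value is 1. *)
Lemma s_metric_sector (theta r s phi psi : R) : PI < theta < 2 * PI ->
  0 < r -> 0 < s -> 0 < phi < theta -> 0 < psi < theta ->
  s_metric (sector theta) (polar r phi) (polar s psi) =
  sqrt (q (ln r - ln s) (Rmin (Rabs (phi - psi)) PI) /
        q (ln r - ln s) (Rmin (Rmin (phi + psi) (2 * theta - (phi + psi))) PI)).
Proof.
intros Ht Hr Hs H1 H2; unfold s_metric; pose proof PI_RGT_0.
rewrite boundary_path_min, Cmod_polar_minus by auto.
set (m := Rmin (phi + psi) (2 * theta - (phi + psi))).
assert (Hm : Rabs (phi - psi) <= m /\ 0 < m).
{ unfold m, Rabs, Rmin; destruct Rcase_abs, Rle_dec; lra. }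
assert (Habs : cos (Rabs (phi - psi)) = cos (phi - psi)).
{ unfold Rabs; destruct Rcase_abs; [apply cos_neg|easy]. }
destruct Rle_dec as [L|L].
- rewrite (Rmin_left _ _ L), <- side_ratio; auto.
  + f_equal; now apply side_cos.
  + apply q_pos; split; [apply Rmin_glb_lt; lra|].
    pose proof (Rmin_r m PI); lra.
- rewrite !Rmin_right by lra.
  pose proof (q_pos (ln r - ln s) PI ltac:(lra)).
  pose proof (q_pos (ln r - ln s) (Rabs (phi - psi))) as Hq.
  assert (Hlt : Rabs (phi - psi) < 2 * PI) by (unfold Rabs; destruct Rcase_abs; lra).
  specialize (Hq ltac:(lra)).
  assert (0 < side r s (phi - psi)).
  { rewrite <- (side_cos _ _ _ _ Habs).
    replace (side r s (Rabs (phi - psi))) with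
      (side r s (Rabs (phi - psi)) / side r s PI * side r s PI).
    - rewrite side_ratio, side_pi by lra.
      apply Rmult_lt_0_compat; [|lra].
      now apply sqrt_lt_R0, Rdiv_lt_0_compat.
    - rewrite side_pi by lra; field; lra. }
  rewrite !Rdiv_diag, sqrt_1; lra.
Qed.

(** The power map multiplies both [t] and the angles by [a]. Conjugation negates the second angle,
    so the denominator has angle [a * (phi + psi)], whose cosine is that of [2 * PI - a * (phi +
    psi) = a * (2 * theta - (phi + psi))]. *)
Lemma th_rho_sector (theta r s phi psi : R) : PI < theta < 2 * PI ->
  0 < r -> 0 < s -> 0 < phi < theta -> 0 < psi < theta ->
  let a := PI / theta in let t := ln r - ln s in
  th (rho_S theta (polar r phi) (polar s psi) / 2) =
  sqrt (q (a * t) (a * Rabs (phi - psi)) /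
        q (a * t) (a * Rmin (phi + psi) (2 * theta - (phi + psi)))).
Proof.
intros Ht Hr Hs H1 H2 a t; pose proof PI_RGT_0.
assert (Ha : 0 < a < 1).
{ unfold a; split; [apply Rdiv_lt_0_compat; lra|].
  apply (proj1 (Rdiv_lt_1 PI theta ltac:(lra))); lra. }
assert (Hat : a * theta = PI) by (unfold a; field; lra).
set (m := Rmin (phi + psi) (2 * theta - (phi + psi))).
assert (Hm : Rabs (phi - psi) < m <= theta).
{ unfold m, Rabs, Rmin; destruct Rcase_abs, Rle_dec; lra. }
pose proof (Rabs_pos (phi - psi)) as Hd.
assert (Hcm : cos (a * phi - - (a * psi)) = cos (a * m)).
{ unfold m, Rmin; destruct Rle_dec; [f_equal; ring|].
  replace (a * (2 * theta - (phi + psi))) with (2 * (a * theta) - (a * phi + a * psi)) by ring.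
  rewrite Hat, (cos_minus (2 * PI)), cos_2PI, sin_2PI.
  replace (a * phi - - (a * psi)) with (a * phi + a * psi) by ring; ring. }
assert (Hcd : cos (a * phi - a * psi) = cos (a * Rabs (phi - psi))).
{ unfold Rabs; destruct Rcase_abs; [rewrite <- cos_neg|]; f_equal; ring. }
unfold rho_S, rho_H; rewrite !cpow_polar by lra; fold a.
replace (Cconj (polar (Rpower s a) (a * psi))) with (polar (Rpower s a) (- (a * psi))).
2: { unfold Cconj, polar; simpl; rewrite cos_neg, sin_neg; f_equal; ring. }
rewrite !Cmod_polar_minus, (side_cos _ _ _ _ Hcm), (side_cos _ _ _ _ Hcd).
assert (Et : ln (Rpower r a) - ln (Rpower s a) = a * t).
{ unfold Rpower, t; rewrite !ln_exp; ring. }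
assert (Ham : 0 <= a * Rabs (phi - psi) < a * m /\ a * m <= PI).
{ rewrite <- Hat; repeat split; [apply Rmult_le_pos|apply Rmult_lt_compat_l|
    apply Rmult_le_compat_l]; lra. }
assert (Hq : 0 < q (a * t) (a * m)) by (apply q_pos; lra).
(* Strictness keeps the argument of [artanh] below 1, where [th] inverts it. *)
assert (Hlt : q (a * t) (a * Rabs (phi - psi)) < q (a * t) (a * m)).
{ unfold q; pose proof (cos_decreasing_1 (a * Rabs (phi - psi)) (a * m)); lra. }
rewrite side_ratio, Et; try apply exp_pos; [|now rewrite Et].
replace (2 * artanh _ / 2) with
  (artanh (sqrt (q (a * t) (a * Rabs (phi - psi)) / q (a * t) (a * m)))) by field.
apply th_artanh; split.
- eapply Rlt_le_trans; [|apply sqrt_pos]; lra.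
- rewrite <- sqrt_1; apply sqrt_lt_1_alt; split.
  + apply Rdiv_le_0_compat; [apply q_nonneg|easy].
  + now apply (proj1 (Rdiv_lt_1 _ _ Hq)).
Qed.

(** * The bisector and sharpness *)

Lemma sqrt_q_ratio_bisector (t : R) : 0 <= t ->
  sqrt (q (2 * t) 0 / q (2 * t) PI) = sinh t / cosh t.
Proof.
intros H; pose proof (cosh_ge_1 t); pose proof (sinh_nonneg t H).
rewrite q_pi; replace 0 with (2 * 0) at 1 by ring; rewrite q_double, sin_0.
replace (_ / _) with ((sinh t / cosh t) * (sinh t / cosh t)) by (field; lra).
apply sqrt_square, Rdiv_le_0_compat; lra.
Qed.

(** The modulus [exp (2 * t)] makes half arguments equal to [t]; the common angle [theta / 2] gives
    [delta = 0] and [sigma = theta], so both metrics become values of tanh. *)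
Lemma bisector_values (theta t : R) : PI < theta < 2 * PI -> 0 <= t ->
  let x := polar (exp (2 * t)) (theta / 2) in let y := polar 1 (theta / 2) in
  let a := PI / theta in
  sector theta x /\ sector theta y /\
  s_metric (sector theta) x y = sinh t / cosh t /\
  th (rho_S theta x y / 2) = sinh (a * t) / cosh (a * t).
Proof.
intros Ht Hpos x y a.
pose proof (exp_pos (2 * t)); pose proof PI_RGT_0.
assert (Hat : a * theta = PI) by (unfold a; field; lra).
assert (Ha : 0 < a) by (apply Rdiv_lt_0_compat; lra).
assert (E0 : Rabs (theta / 2 - theta / 2) = 0) by (rewrite Rminus_diag; apply Rabs_R0).
assert (E1 : Rmin (theta / 2 + theta / 2) (2 * theta - (theta / 2 + theta / 2)) = theta).
{ rewrite Rmin_left; lra. }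
split; [|split; [|split]]; try (apply sector_polar; lra); unfold x, y.
- rewrite s_metric_sector, E0, E1, ln_exp, ln_1, Rminus_0_r by lra.
  rewrite Rmin_left, Rmin_right by lra; now apply sqrt_q_ratio_bisector.
- rewrite th_rho_sector, E0, E1, ln_exp, ln_1, Rminus_0_r by lra.
  fold a; rewrite Hat, Rmult_0_r.
  replace (a * (2 * t)) with (2 * (a * t)) by ring.
  apply sqrt_q_ratio_bisector, Rmult_le_pos; lra.
Qed.

Lemma tanh_le (x : R) : 0 <= x -> sinh x / cosh x <= x.
Proof.
intros Hx; pose proof (cosh_ge_1 x).
apply (Rmult_le_reg_r (cosh x)); [lra|].
replace (sinh x / cosh x * cosh x) with (sinh x) by (field; lra).
apply Rminus_le_0.
apply (nonneg_of_derive (fun x => x * cosh x - sinh x) (fun x => x * sinh x)); auto.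
- intros y; replace (y * sinh y) with (1 * cosh y + y * sinh y - cosh y) by ring.
  apply (is_derive_minus (fun x => x * cosh x) sinh); [|apply is_derive_sinh].
  apply (is_derive_mult (fun x => x) cosh);
    [apply is_derive_Reals, derivable_pt_lim_id|apply is_derive_cosh|intros; apply Rmult_comm].
- intros y [Hy _]; apply Rmult_le_pos; auto using sinh_nonneg.
- rewrite sinh_0; lra.
Qed.

Lemma sinh_ge (x : R) : 0 <= x -> x <= sinh x.
Proof.
intros Hx; apply Rminus_le_0.
apply (nonneg_of_derive (fun x => sinh x - x) (fun x => cosh x - 1)); auto.
- intros y; apply (is_derive_minus sinh (fun x => x));
    [apply is_derive_sinh|apply is_derive_Reals, derivable_pt_lim_id].
- intros y _; pose proof (cosh_ge_1 y); lra.
- rewrite sinh_0; lra.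
Qed.

Theorem theorem4p6 (theta : R) (Htheta : PI < theta < 2 * PI) :
  (forall x y : C, sector theta x -> sector theta y ->
     (PI / theta) * s_metric (sector theta) x y <= th (rho_S theta x y / 2) /\
     th (rho_S theta x y / 2) <= s_metric (sector theta) x y)
  /\
  (* sharpness: neither constant can be improved *)
  (forall c : R, PI / theta < c ->
     exists x y : C, sector theta x /\ sector theta y /\
       th (rho_S theta x y / 2) < c * s_metric (sector theta) x y)
  /\
  (forall c : R, c < 1 ->
     exists x y : C, sector theta x /\ sector theta y /\
       c * s_metric (sector theta) x y < th (rho_S theta x y / 2)).
Proof.
pose proof PI_RGT_0 as Hpi.
assert (Ha : 0 < PI / theta < 1).
{ split; [apply Rdiv_lt_0_compat|apply (proj1 (Rdiv_lt_1 PI theta ltac:(lra)))]; lra. }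
split; [|split].
- intros x y Hx Hy.
  destruct (sector_polar_inv _ _ Hx) as [r [phi [Hr [Hphi ->]]]].
  destruct (sector_polar_inv _ _ Hy) as [s [psi [Hs [Hpsi ->]]]].
  rewrite s_metric_sector, th_rho_sector by auto.
  assert (Hat : PI / theta * theta = PI) by (field; lra).
  set (a := PI / theta) in *; set (t := ln r - ln s).
  set (m := Rmin (phi + psi) (2 * theta - (phi + psi))).
  assert (Hm : Rabs (phi - psi) < m <= theta).
  { unfold m, Rabs, Rmin; destruct Rcase_abs, Rle_dec; lra. }
  pose proof (Rabs_pos (phi - psi)) as Hd.
  assert (Hq : 0 < q t (Rmin m PI)).
  { pose proof (Rmin_r m PI); apply q_pos; split; [apply Rmin_glb_lt|]; lra. }
  assert (Ham : 0 < a * m <= PI).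
  { rewrite <- Hat; split; [apply Rmult_lt_0_compat|apply Rmult_le_compat_l]; lra. }
  assert (Hq' : 0 < q (a * t) (a * m)) by (apply q_pos; lra).
  pose proof (q_lower a Ha t (Rabs (phi - psi)) m ltac:(lra) (proj2 Ham)) as Hlo.
  pose proof (q_upper a Ha t (Rabs (phi - psi)) m ltac:(lra) (proj2 Ham)) as Hup.
  split.
  (* Moving [a] under the root as [a * a] reduces the bound to [q_lower] after
     cross-multiplication. *)
  + rewrite <- (sqrt_square a) at 1 by lra.
    rewrite <- sqrt_mult_alt by nra; apply sqrt_le_1_alt.
    apply (Rmult_le_reg_r (q t (Rmin m PI) * q (a * t) (a * m))); [nra|].
    field_simplify; lra.
  + apply sqrt_le_1_alt.
    apply (Rmult_le_reg_r (q t (Rmin m PI) * q (a * t) (a * m))); [nra|].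
    field_simplify; lra.
- intros c Hc.
  set (a := PI / theta) in *.
  assert (Hca : 1 < c / a).
  { apply (Rmult_lt_reg_r a); [lra|]; field_simplify; lra. }
  (* Chosen so that [cosh t < exp t = c / a]; then [tanh (a * t) <= a * t < c * t / cosh t <= c *
     tanh t]. *)
  set (t := ln (c / a)).
  assert (Ht : 0 < t) by (rewrite <- ln_1; apply ln_increasing; lra).
  destruct (bisector_values theta t Htheta ltac:(lra)) as [H1 [H2 [H3 H4]]].
  do 2 eexists; split; [exact H1|split; [exact H2|]].
  rewrite H3, H4; fold a.
  pose proof (tanh_le (a * t) ltac:(nra)); pose proof (sinh_ge t ltac:(lra)).
  pose proof (cosh_ge_1 t).
  apply Rle_lt_trans with (a * t); auto.
  assert (Hch : cosh t < c / a).
  { rewrite <- (exp_ln (c / a)) by lra; fold t.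
    assert (exp (- t) < exp t) by (apply exp_increasing; lra).
    unfold cosh; lra. }
  apply (Rmult_lt_reg_r (cosh t)); [lra|].
  replace (c * (sinh t / cosh t) * cosh t) with (c * sinh t) by (field; lra).
  apply Rlt_le_trans with (c * t); [|nra].
  assert (Hac : a * cosh t < c).
  { apply (Rmult_lt_compat_l a) in Hch; [|lra].
    replace (a * (c / a)) with c in Hch by (field; lra); auto. }
  nra.
- intros c Hc; set (a := PI / theta) in *.
  (* A nonnegative bound [k < 1] above [c]: as the tanh value of [s_metric] lies in [0, 1], it
     suffices that [k] is below the tanh value of [th]. *)
  set (k := Rmax c 0).
  assert (Hk : c <= k /\ 0 <= k < 1).
  { unfold k; repeat split; [apply Rmax_l|apply Rmax_r|apply Rmax_lub_lt; lra]. }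
  (* With [E = exp u = 2 / (1 - k)], [1 - tanh u = 2 / (E^2 + 1) < 2 / E = 1 - k]. *)
  set (u := ln (2 / (1 - k))).
  assert (Hk2 : 2 <= 2 / (1 - k)).
  { apply (Rmult_le_reg_r (1 - k)); [lra|]; field_simplify; lra. }
  assert (Hu : 0 < u) by (rewrite <- ln_1; apply ln_increasing; lra).
  assert (Hat : a * (u / a) = u) by (field; lra).
  destruct (bisector_values theta (u / a) Htheta) as [H1 [H2 [H3 H4]]].
  { left; apply Rdiv_lt_0_compat; lra. }
  do 2 eexists; split; [exact H1|split; [exact H2|]].
  rewrite H3, H4; fold a; rewrite Hat.
  pose proof (cosh_ge_1 (u / a)) as Hch.
  assert (Hs : 0 <= sinh (u / a) / cosh (u / a) <= 1).
  { split.
    - apply Rdiv_le_0_compat; [|lra].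
      apply sinh_nonneg; left; apply Rdiv_lt_0_compat; lra.
    - apply (Rmult_le_reg_r (cosh (u / a))); [lra|]; field_simplify; [|lra].
      unfold sinh, cosh; pose proof (exp_pos (- (u / a))); lra. }
  apply Rle_lt_trans with k; [nra|].
  set (E := exp u).
  assert (HE : E = 2 / (1 - k)) by (unfold E, u; apply exp_ln; lra).
  assert (HE2 : E * (1 - k) = 2) by (rewrite HE; field; lra).
  replace (sinh u / cosh u) with ((E * E - 1) / (E * E + 1)).
  2: { unfold sinh, cosh; rewrite exp_Ropp; fold E; field; nra. }
  apply (Rmult_lt_reg_r (E * E + 1)); [nra|].
  field_simplify; [|nra]; nra.
Qed.
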